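(* Let $L\subset\mathbb{R}P^n$ be a projective subspace with $\dim L=n-2$ and let $A\subset\mathbb{R}P^n$ be an $L$-convex-concave set. Then for any four hyperplanes $N_1,\dots,N_4\subset\mathbb{R}P^n$ containing $L$ there exists a projective line in $\mathbb{R}P^n$ intersecting all four sections $A\cap N_i$, $i=1,\dots,4$.
   Context: For a projective subspace $T\subset\mathbb{R}P^n$, $\mathbb{R}P^n/T$ is the projective space of dimension $n-\dim T-1$ whose points are the $(\dim T+1)$-dimensional subspaces containing $T$; the projection from the center $T$ sends $x\notin T$ to the span of $x$ and $T$. The empty subspace has dimension $-1$. A nonempty subset of a projective space is convex if it is disjoint from some hyperplane $H$ and is convex in the affine space obtained by removing $H$. A closed set $A\subset\mathbb{R}P^n$ is $L$-convex-concave if: 1) $A\cap L=\emptyset$; 2) for every $(\dim L+1)$-dimensional subspace $N\supset L$ the section $A\cap N$ is convex; 3) for every $(\dim L-1)$-dimensional subspace $T\subset L$ the complement in $\mathbb{R}P^n/T$ of the projection of $A$ from the center $T$ is an open convex set. *)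

(* Defs.v *)
(* MathComp-Analysis: the real field is an arbitrary R : realType. *)
From HB Require Import structures.
From mathcomp Require Import all_boot all_order all_algebra.
From mathcomp Require Import all_classical all_reals all_analysis.
From mathcomp Require Import zify.
Set Implicit Arguments.
Unset Strict Implicit.
Unset Printing Implicit Defensive.
Import Order.TTheory GRing.Theory Num.Theory.
Import numFieldNormedType.Exports.
Local Open Scope classical_set_scope.
Local Open Scope ring_scope.

(* A projective subspace of RP^n is a linear subspace of R^(n+1); the empty
   one is the zero subspace. *)
Notation proj_subspace R n := {vspace 'rV[R]_n.+1}.

Definition pdim (R : realType) (n : nat) (W : proj_subspace R n) : int :=
  (\dim W)%:Z - 1.

(* RP^n / T. *)
Record pquot (R : realType) (n : nat) (T : proj_subspace R n) := PQuot {
  pquot_val :> proj_subspace R n;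
  _ : (T <= pquot_val)%VS && (pdim pquot_val == pdim T + 1) }.

(* RP^n itself is the quotient by the empty subspace. *)
Notation RP R n := (@pquot R n 0%VS).

HB.instance Definition _ (R : realType) (n : nat) (T : proj_subspace R n) :=
  [isSub for @pquot_val R n T].
HB.instance Definition _ (R : realType) (n : nat) (T : proj_subspace R n) :=
  [Choice of pquot T by <:].

Section Topology.
Variables (R : realType) (n : nat) (T : proj_subspace R n).

(* The preimage of U under the canonical map R^(n+1) \ T -> RP^n / T, which
   sends v to T + <[v]>, the only point of RP^n / T that contains v. *)
Definition cone (U : set (pquot T)) : set 'rV[R]_n.+1 :=
  [set v | v \notin T /\ exists2 x, U x & v \in (x : proj_subspace R n)].

Lemma dim_addv_line (v : 'rV[R]_n.+1) : v \notin T ->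
  \dim (T + <[v]>) = (\dim T).+1.
Proof.
move=> vT; rewrite dimv_disjoint_sum.
  rewrite dim_vline; case: eqVneq vT => [->|_ _]; first by rewrite mem0v.
  by rewrite addn1.
apply/eqP; rewrite -subv0; apply/subvP => w; rewrite memv_cap => /andP[wT].
case/vlineP => k wE; rewrite memv0 wE; case: (eqVneq k 0) => [->|k0].
  by rewrite scale0r.
by case/negP: vT; rewrite -(scalerK k0 v) -wE memvZ.
Qed.

Lemma pquot_uniq (x y : pquot T) (v : 'rV[R]_n.+1) : v \notin T ->
  v \in (x : proj_subspace R n) -> v \in (y : proj_subspace R n) -> x = y.
Proof.
move=> vT vx vy; suff xE (z : pquot T) : v \in (z : proj_subspace R n) ->
  (T + <[v]>)%VS = z by apply: val_inj; rewrite /= -(xE x) // -(xE y).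
case: z => W /= /andP[TW /eqP dW] vW.
have {}dW : \dim W = (\dim T).+1 by move: dW; rewrite /pdim; lia.
by apply/eqP; rewrite eqEdim subv_add TW -memvE vW /= dW dim_addv_line.
Qed.

Lemma pquot_ex (v : 'rV[R]_n.+1) : v \notin T ->
  exists x : pquot T, v \in (x : proj_subspace R n).
Proof.
move=> vT; have H : (T <= T + <[v]>)%VS && (pdim (T + <[v]>) == pdim T + 1).
  by rewrite addvSl /pdim dim_addv_line //; lia.
by exists (PQuot H); rewrite /= memvE addvSr.
Qed.

Lemma open_notin_vspace : open [set v | v \notin T].
Proof.
rewrite openE => v /= vT.
pose f : 'End('rV[R]_n.+1) := (\1 - projv T)%VF.
have fE w : (w \in T) = (f w == 0).
  rewrite /f add_lfunE opp_lfunE id_lfunE subr_eq0; apply/idP/eqP => [wT|->].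
    by rewrite projv_id.
  exact: memv_proj.
have [j fj] : exists j, f v 0 j != 0.
  apply: contrapT => H; case/negP: vT; rewrite fE; apply/eqP/rowP => j.
  by rewrite mxE; apply/eqP; apply: contrapT => /negP h; apply: H; exists j.
have fc : continuous (fun w : 'rV[R]_n.+1 => f w 0 j).
  have -> : (fun w : 'rV[R]_n.+1 => f w 0 j) =
            (fun w : 'rV[R]_n.+1 =>
               \sum_(i < n.+1) w 0 i * f (delta_mx 0 i) 0 j).
    apply/funext => w; rewrite {1}(row_sum_delta w) linear_sum summxE.
    by apply: eq_bigr => i _; rewrite linearZ mxE.
  apply: continuous_big; first exact: add_continuous.
  move=> i _ w.
  by apply: continuousM; [exact: coord_continuous | exact: cst_continuous].
have: \forall w \near v, f w 0 j != 0.
  apply: (fc v [set r | r != 0]); apply: open_nbhs_nbhs.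
  by split=> //; exact: open_neq.
apply: filterS => w /=; apply: contraNN; rewrite fE => /eqP ->.
by rewrite mxE.
Qed.

Definition pquot_open : set_system (pquot T) := [set U | open (cone U)].

Lemma pquot_openT : pquot_open setT.
Proof.
rewrite /pquot_open /= (_ : cone _ = [set v | v \notin T]).
  exact: open_notin_vspace.
apply/seteqP; split=> v /= => [[]//|vT]; split=> //.
by have [x vx] := pquot_ex vT; exists x.
Qed.

Lemma pquot_openI (U W : set (pquot T)) :
  pquot_open U -> pquot_open W -> pquot_open (U `&` W).
Proof.
rewrite /pquot_open /= (_ : cone (U `&` W) = cone U `&` cone W).
  exact: openI.
apply/seteqP; split=> v /= => [[vT [x [Ux Wx] vx]]|].
  by split; split=> //; exists x.
move=> [[vT [x Ux vx]] [_ [y Wy vy]]]; split=> //; exists x => //; split=> //.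
by rewrite (pquot_uniq vT vx vy).
Qed.

Lemma pquot_open_bigU (I : Type) (U : I -> set (pquot T)) :
  (forall i, pquot_open (U i)) -> pquot_open (\bigcup_i U i).
Proof.
move=> oU; rewrite /pquot_open /=.
rewrite (_ : cone _ = \bigcup_i cone (U i)); first by apply: bigcup_open => i _; exact: oU.
apply/seteqP; split=> v /= => [[vT [x [i _ Ux] vx]]|[i _ [vT [x Ux vx]]]].
  by exists i => //; split=> //; exists x.
by split=> //; exists x => //; exists i.
Qed.

(* Quotient topology. *)
HB.instance Definition _ :=
  isOpenTopological.Build (pquot T) pquot_openT pquot_openI pquot_open_bigU.

Lemma pquot_openE (U : set (pquot T)) : open U = open (cone U).
Proof. by []. Qed.

End Topology.

Section ConvexConcave.
Variables (R : realType) (n : nat).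
Implicit Types L T N H W : proj_subspace R n.

Definition hyperplane H : Prop := pdim H = n%:Z - 1.

Definition points T W : set (pquot T) := [set x | (x <= W)%VS].

(* For a hyperplane H containing T, normalizing representatives so that they
   lie in u + H, where u is any vector outside H, identifies the complement of
   H in RP^n / T with the affine space (u + H) / T.  A subset of (u + H) / T is
   convex iff its preimage in u + H is. *)
Definition affine_convex T H (C : set (pquot T)) : Prop :=
  forall u, u \notin H -> convex_set (cone C `&` [set v | v - u \in H]).

(* The hyperplanes of RP^n / T are the hyperplanes of RP^n containing T. *)
Definition proj_convex T (C : set (pquot T)) : Prop :=
  C !=set0 /\
  exists H, [/\ hyperplane H, (T <= H)%VS, C `&` points H = set0 &
                affine_convex H C].

Definition projection T (A : set (RP R n)) : set (pquot T) :=
  [set y | exists2 x : RP R n, A x &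
           ~~ (x <= T)%VS /\ (y : {vspace _}) = (x + T)%VS].
Arguments projection : clear implicits.

Definition convex_concave L (A : set (RP R n)) : Prop :=
  [/\ closed A,
      A `&` points L = set0,
      forall N, (L <= N)%VS -> pdim N = pdim L + 1 ->
        proj_convex (A `&` points N) &
      forall T, (T <= L)%VS -> pdim T = pdim L - 1 ->
        open (~` projection T A) /\ proj_convex (~` projection T A)].

End ConvexConcave.

Arguments projection {R n} T A.

(* Main.v *)
(* In vector terms, a hyperplane through L is L + <w>, and the section of A by
   it is encoded by the compact convex set S(w) of the vectors v in w + L whose
   line is a point of A; S(k w) = k S(w).

   By condition 3, every p in S(e2) has a q in S(e1) with a q + b p in
   S(a e1 + b e2).  Otherwise the nearest point property separates S(a e1 + b e2) from
   a S(e1) + b p by a functional on L; projecting from its kernel T, a segment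
   in the complement of the projection of A passes through the image of p.

   For four sections S(e1), S(e2), S(f1), S(f2) with fi = ai e1 + bi e2, minimize
   |r1|^2 + |r2|^2 over wi in S(fi), x in S(e1), y in S(e2), where
   ri = wi - (ai x + bi y).  At the minimum, r1.r1' + r2.r2' >= |r1|^2 + |r2|^2
   for all competing residuals r'.  Let p minimize b1 r1.p on S(e2) and p'
   minimize a2 r2.p' on S(e1), and choose q in S(e1), q' in S(e2) with
   a1 q + b1 p in S(f1) and a2 p' + b2 q' in S(f2).  These four points have
   residuals b1 (p - q') and a2 (p' - q), so the left-hand side is <= 0 for
   them.  Hence r1 = r2 = 0, and the line through x and y meets all four
   sections. *)
Require Import Defs.
From HB Require Import structures.
From mathcomp Require Import all_boot all_order all_algebra.
From mathcomp Require Import all_classical all_reals all_analysis.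
From mathcomp Require Import zify ring lra.
Import Order.TTheory GRing.Theory Num.Theory.
Import numFieldNormedType.Exports.
Local Open Scope classical_set_scope.
Local Open Scope ring_scope.
Set Implicit Arguments.
Unset Strict Implicit.
Unset Printing Implicit Defensive.

(** * Convexity, minima on compact sets and linear functionals *)

Lemma convex_setP (R : realType) (E : lmodType R) (S : set E) :
  convex_set S <-> forall x y (t : R), 0 <= t <= 1 -> S x -> S y ->
    S (t *: x + (1 - t) *: y).
Proof.
split=> [cS x y t /andP[t0 t1] Sx Sy|cS x y l /set_mem Sx /set_mem Sy].
  by have := cS x y (Itv01 t0 t1) (mem_set Sx) (mem_set Sy); rewrite inE.
by apply/mem_set/cS => //; rewrite ge0 le1.
Qed.

Lemma compact_min (R : realType) (T : topologicalType) (f : T -> R) (S : set T) :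
  S !=set0 -> compact S -> continuous f ->
  exists2 x, S x & forall y, S y -> f x <= f y.
Proof.
move=> S0 cS cf.
have [x /set_mem Sx xmin] := compact_EVT_min S0 cS (continuous_subspaceT cf).
by exists x => // y /mem_set; exact: xmin.
Qed.

Lemma scalar_continuous (R : realType) (n : nat) (f : {scalar 'rV[R]_n.+1}) :
  continuous f.
Proof.
have -> : f = (fun v : 'rV[R]_n.+1 => \sum_(i < n.+1) v 0 i * f (delta_mx 0 i))
    :> (_ -> _).
  apply/funext => v; rewrite {1}(row_sum_delta v) linear_sum.
  by apply: eq_bigr => i _; rewrite linearZ.
apply: continuous_big; first exact: add_continuous.
move=> i _ v; pose c : R := f (delta_mx 0 i).
apply: (@continuousM R _ (fun w : 'rV[R]_n.+1 => w 0 i) (fun=> c)).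
  exact: coord_continuous.
exact: cst_continuous.
Qed.

(** The map [v - projv W v] kills [W] but not [d], so one of its coordinates, divided by its value
    at [d], serves as [f]. *)
Lemma scalar_separation (R : realType) (n : nat) (W : {vspace 'rV[R]_n.+1})
    (d : 'rV[R]_n.+1) :
  d \notin W -> exists2 f : {scalar 'rV[R]_n.+1},
    f d = 1 & forall v, v \in W -> f v = 0.
Proof.
move=> dW; pose g : 'End('rV[R]_n.+1) := (\1 - projv W)%VF.
have gE v : g v = v - projv W v by rewrite add_lfunE opp_lfunE id_lfunE.
have [j gj] : exists j, g d 0 j != 0.
  apply: contrapT => H; case/negP: dW.
  suff /eqP : g d = 0 by rewrite gE subr_eq0 => /eqP ->; exact: memv_proj.
  apply/rowP => j; rewrite mxE; apply/eqP; apply: contrapT => /negP h.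
  by apply: H; exists j.
pose f v : R := g v 0 j / g d 0 j.
have fl : scalar f by move=> a u v; rewrite /f linearP !mxE mulrDl mulrA.
pose F : {scalar 'rV[R]_n.+1} :=
  HB.pack f (GRing.isLinear.Build _ _ _ _ f fl).
exists F => [|v vW]; rewrite /= /f; first by rewrite divff.
by rewrite gE projv_id // subrr mxE mul0r.
Qed.

(** * The dot product and nearest points *)

Definition dot (R : realType) (n : nat) (u v : 'rV[R]_n) : R :=
  \sum_j u 0 j * v 0 j.

Lemma dot_linear (R : realType) (n : nat) (u : 'rV[R]_n) : scalar (dot u).
Proof.
move=> a v w; rewrite /dot mulr_sumr -big_split /=; apply: eq_bigr => j _.
by rewrite !mxE mulrDr mulrCA.
Qed.

HB.instance Definition _ (R : realType) (n : nat) (u : 'rV[R]_n) :=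
  GRing.isLinear.Build R 'rV[R]_n R *%R (dot u) (dot_linear u).

Lemma dotBr (R : realType) (n : nat) (u v w : 'rV[R]_n) :
  dot u (v - w) = dot u v - dot u w.
Proof. exact: linearB. Qed.

Lemma dotZr (R : realType) (n : nat) (a : R) (u v : 'rV[R]_n) :
  dot u (a *: v) = a * dot u v.
Proof. exact: linearZ. Qed.

Lemma dotC (R : realType) (n : nat) (u v : 'rV[R]_n) : dot u v = dot v u.
Proof. by apply: eq_bigr => j _; rewrite mulrC. Qed.

Lemma dot_ge0 (R : realType) (n : nat) (u : 'rV[R]_n) : 0 <= dot u u.
Proof. by apply: sumr_ge0 => j _; rewrite -expr2 sqr_ge0. Qed.

Lemma dot_eq0 (R : realType) (n : nat) (u : 'rV[R]_n) : (dot u u == 0) = (u == 0).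
Proof.
rewrite /dot psumr_eq0 => [|j _]; last by rewrite -expr2 sqr_ge0.
apply/allP/eqP => [h|-> j _]; last by rewrite mxE mul0r eqxx.
apply/rowP => j; rewrite mxE; apply/eqP.
by have := h j (mem_index_enum _); rewrite mulf_eq0 orbb.
Qed.

Lemma dot_sqr_continuous (R : realType) (n : nat) :
  continuous (fun u : 'rV[R]_n => dot u u).
Proof.
apply: continuous_big; first exact: add_continuous.
by move=> j _ u; apply: continuousM; exact: coord_continuous.
Qed.

(** This is the first-order condition at the point of [S] of least norm: if it failed for [r'], a
    small move from [r] towards [r'] would shorten [r]. Pairs are used because two residuals are
    minimized together later. *)
Lemma nearest_point (R : realType) (n : nat) (S : set ('rV[R]_n * 'rV[R]_n)) :
  S !=set0 -> compact S -> convex_set S ->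
  exists2 r, S r & forall r', S r' ->
    dot r.1 r.1 + dot r.2 r.2 <= dot r.1 r'.1 + dot r.2 r'.2.
Proof.
move=> S0 cS /convex_setP vS.
pose N (r : 'rV[R]_n * 'rV[R]_n) := dot r.1 r.1 + dot r.2 r.2.
have cN : continuous N.
  move=> r.
  have c1 : {for r, continuous (fun r : 'rV[R]_n * 'rV[R]_n => dot r.1 r.1)}.
    exact: (@continuous_comp _ _ _ fst _ _ (@cvg_fst _ _ _ _ _) (@dot_sqr_continuous R n _)).
  have c2 : {for r, continuous (fun r : 'rV[R]_n * 'rV[R]_n => dot r.2 r.2)}.
    exact: (@continuous_comp _ _ _ snd _ _ (@cvg_snd _ _ _ _ _) (@dot_sqr_continuous R n _)).
  exact: (continuousD c1 c2).
have [r Sr rmin] := compact_min S0 cS cN.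
exists r => // r' Sr'; rewrite leNgt; apply/negP => lt_r'.
pose D := dot r.1 r'.1 + dot r.2 r'.2 - N r.
pose E := N (r' - r).
have E0 : 0 <= E by rewrite addr_ge0 // dot_ge0.
have D0 : D < 0 by rewrite subr_lt0.
(* Along the segment the squared norm is [N r + 2 t D + t^2 E]. The denominator [E - D] is positive
   even if [E] is zero, this [t] is at most 1, and the change is [t D (1 + t) < 0]. *)
pose t := - D / (E - D).
have ED : 0 < E - D by lra.
have t0 : 0 < t by rewrite divr_gt0 // oppr_gt0.
have t1 : t <= 1 by rewrite ler_pdivrMr //; lra.
have tE : t * (E - D) = - D by rewrite divfK // gt_eqF.
have := rmin _ (vS r' r t _ Sr' Sr).
rewrite (ltW t0) t1 => /(_ isT).
suff -> : N (t *: r' + (1 - t) *: r) = N r + 2 * t * D + t ^+ 2 * E by nra.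
rewrite {t0 t1 tE}; clearbody t; rewrite /E /D /N /= !linearD !linearN /= !linearZ /=.
rewrite !(dotC (_ + _) _) !linearD !linearN /= !linearZ /=.
rewrite !(dotC r'.1 r.1) !(dotC r'.2 r.2).
by ring.
Qed.

Lemma continuous_pair (X U V : topologicalType) (f : X -> U) (g : X -> V) :
  continuous f -> continuous g -> continuous (fun x => (f x, g x)).
Proof. by move=> cf cg x; exact: (cvg_pair (cf x) (cg x)). Qed.

Lemma continuous_residual (R : realType) (X : topologicalType)
    (V : normedModType R) (f g h : X -> V) (a b : R) :
  continuous f -> continuous g -> continuous h ->
  continuous (fun x => f x - (a *: g x + b *: h x)).
Proof.
move=> cf cg ch x; apply: cvgB; first exact: cf.
by apply: cvgD; apply: cvgZl_tmp; [exact: cg|exact: ch].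
Qed.

(** * Cones over subsets of RP^n / T, projections and charts *)

Section Cone.
Variables (R : realType) (n : nat) (T : proj_subspace R n).
Implicit Types (U : set (pquot T)) (x : pquot T) (v : 'rV[R]_n.+1).

Lemma pquot_sub x : (T <= x)%VS.
Proof. by case: x => W /= /andP[]. Qed.

Lemma pquotE x v : v \notin T -> v \in (x : proj_subspace R n) ->
  x = (T + <[v]>)%VS :> proj_subspace R n.
Proof.
case: x => W /= /andP[TW /eqP dW] vT vW.
have {}dW : \dim W = (\dim T).+1 by move: dW; rewrite /pdim; lia.
apply/eqP; rewrite eq_sym eqEdim subv_add TW -memvE vW /=.
by rewrite dW dim_addv_line.
Qed.

Lemma coneZ U (k : R) v : k != 0 -> cone U (k *: v) <-> cone U v.
Proof.
move=> k0; rewrite /cone /= rpredZeq (negPf k0) /=.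
by split=> -[vT [x Ux vx]]; split=> //; exists x => //; move: vx;
  rewrite rpredZeq (negPf k0).
Qed.

Lemma coneN U v : cone U (- v) <-> cone U v.
Proof. by rewrite -scaleN1r; apply: coneZ; rewrite oppr_eq0 oner_neq0. Qed.

Lemma coneC U v : cone (~` U) v <-> v \notin T /\ ~ cone U v.
Proof.
split=> [[vT [x nUx vx]]|[vT nUv]]; split=> //.
  by move=> [_ [y Uy vy]]; apply: nUx; rewrite (pquot_uniq vT vx vy).
have [x vx] := pquot_ex vT.
by exists x => //= Ux; apply: nUv; split=> //; exists x.
Qed.

Lemma cone_points U (W : proj_subspace R n) v : (T <= W)%VS ->
  cone (U `&` points W) v <-> cone U v /\ v \in W.
Proof.
move=> TW; split=> [[vT [x [Ux xW] vx]]|[[vT [x Ux vx]] vW]].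
  by split; [split=> //; exists x|exact: subvP xW _ vx].
split=> //; exists x => //; split=> //; rewrite /points /= (pquotE vT vx).
by rewrite subv_add TW -memvE.
Qed.

Lemma cone_nonempty U : U !=set0 -> exists v, cone U v.
Proof.
move=> [[W /= HW] Ux]; have /andP[TW /eqP dW] := HW.
have : ~~ (W <= T)%VS.
  by apply/negP => /dimvS; move: dW; rewrite /pdim; lia.
by case/subvPn => v vW vT; exists v; split=> //; exists (PQuot HW).
Qed.

End Cone.

(** The point of RP^n / T through [v] is [T + <[v]>], and the points of RP^n projected to it are the
    lines spanned by the vectors [v + t]. *)
Lemma cone_projection (R : realType) (n : nat) (T : proj_subspace R n)
    (A : set (RP R n)) (v : 'rV[R]_n.+1) :
  cone (projection T A) v <->
  v \notin T /\ exists2 t, t \in T & cone A (v + t).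
Proof.
split=> [[vT [y [x Ax [_ yE]]]]|[vT [t tT [vt0 [x Ax vtx]]]]].
  rewrite yE => /memv_addP[a ax [t tT vE]]; split=> //.
  exists (- t); first by rewrite rpredN.
  rewrite vE addrK; split; last by exists x.
  by apply: contra vT; rewrite memv0 vE => /eqP ->; rewrite add0r.
split=> //; have [y vy] := pquot_ex vT; exists y => //.
have vtT : v + t \notin T by rewrite rpredDr.
have xE : (x : proj_subspace R n) = <[v + t]>%VS by rewrite (pquotE vt0 vtx) add0v.
exists x => //; split; first by apply: contra vtT => /subvP; exact.
rewrite (@pquotE _ _ _ y (v + t)) // 1?addvC ?xE //.
by rewrite rpredD // (subvP (pquot_sub y)).
Qed.

(** As [H] has codimension one, a functional vanishing on [H] with value 1 at [d] has no larger
    kernel. It serves to normalize: if [f v] is nonzero, [(f v)^-1 *: v] lies in the chart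
    [d + H]. *)
Lemma hyperplane_kernel (R : realType) (n : nat) (H : proj_subspace R n)
    (d : 'rV[R]_n.+1) : hyperplane H -> d \notin H ->
  exists2 f : {scalar 'rV[R]_n.+1}, f d = 1 & forall v, (v \in H) = (f v == 0).
Proof.
move=> hH dH; have [f fd fH] := scalar_separation dH; exists f => // v.
have : v \in (H + <[d]>)%VS.
  suff /eqP -> : (H + <[d]>)%VS == fullv by rewrite memvf.
  rewrite eqEdim subvf dim_addv_line // dimvf /= /dim /= mul1n.
  by move: hH; rewrite /hyperplane /pdim; lia.
case/memv_addP => h hH' [_ /vlineP[k ->] ->].
rewrite linearD linearZ /= fd (fH _ hH') add0r mulr1.
rewrite rpredDl // rpredZeq (negPf dH) orbF //.
Qed.

(** * Slices of A by translates of L: nonempty, convex, compact *)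

Definition slice (R : realType) (n : nat) (L : proj_subspace R n)
    (A : set (RP R n)) (w : 'rV[R]_n.+1) : set 'rV[R]_n.+1 :=
  [set v | cone A v /\ v - w \in L].

Lemma sliceZ (R : realType) (n : nat) (L : proj_subspace R n)
    (A : set (RP R n)) (k : R) (w v : 'rV[R]_n.+1) : k != 0 ->
  slice L A (k *: w) (k *: v) <-> slice L A w v.
Proof.
by move=> k0; rewrite /slice /= -scalerBr rpredZeq (negPf k0) coneZ.
Qed.

Lemma slice_notin (R : realType) (n : nat) (L : proj_subspace R n)
    (A : set (RP R n)) (w v : 'rV[R]_n.+1) :
  w \notin L -> slice L A w v -> v \notin L.
Proof.
by move=> wL [_ vw]; apply: contra wL => vL; rewrite -(subKr v w) rpredB.
Qed.

Section Slices.
Variables (R : realType) (n : nat) (L : proj_subspace R n) (A : set (RP R n)).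
Hypothesis ccA : convex_concave L A.
Implicit Types w v : 'rV[R]_n.+1.

Lemma cone_disjoint v : cone A v -> v \in L -> False.
Proof.
move=> Av vL; have [_ + _ _] := ccA => AL.
have : cone (A `&` points L) v by apply/cone_points; rewrite ?sub0v.
by rewrite AL => -[_ []].
Qed.

Lemma section_convex w : w \notin L ->
  proj_convex (A `&` points (L + <[w]>)).
Proof.
move=> wL; have [_ _ + _] := ccA; apply; first exact: addvSl.
by rewrite /pdim dim_addv_line //; lia.
Qed.

Lemma slice_in_section w v : slice L A w v -> v \in (L + <[w]>)%VS.
Proof.
by case=> _ vw; rewrite -(subrK w v) memv_add // memv_line.
Qed.

(** A vector over the section has a nonzero component along [w], because [A] misses [L]; dividing by
    it lands in [w + L]. *)
Lemma slice_neq0 w : w \notin L -> slice L A w !=set0.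
Proof.
move=> wL; have [/cone_nonempty[v] + _] := section_convex wL.
rewrite cone_points ?sub0v // => -[Av /memv_addP[l lL [_ /vlineP[k ->] vE]]].
have k0 : k != 0.
  apply/eqP => k0; apply: (cone_disjoint Av).
  by rewrite vE k0 scale0r addr0.
exists (k^-1 *: v); split; first by apply/coneZ; rewrite ?invr_eq0.
by rewrite vE scalerDr scalerK // addrK rpredZ.
Qed.

(** Condition 2 gives convexity in the chart of some hyperplane [H], not in [w + L]. If [f x] and
    [f y] have the same sign, the segment from [x] to [y] is, up to rescaling, a segment of that
    chart. If the signs differ, the chart segment contains a multiple of [x - y], a vector of [L],
    which [A] misses. *)
Lemma slice_convex w : w \notin L -> convex_set (slice L A w).
Proof.
move=> wL; apply/convex_setP => x y t /andP[t0 t1] Sx Sy.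
have [+ [H [hH _ NH cH]]] := section_convex wL.
move=> /cone_nonempty[d] /[dup] Nd /cone_points; rewrite sub0v => -/(_ isT)[Ad dN].
have notinH v : cone (A `&` points (L + <[w]>)) v -> v \notin H.
  move=> Nv; apply/negP => vH.
  have : cone (A `&` points (L + <[w]>) `&` points H) v.
    by apply/cone_points; rewrite ?sub0v.
  by rewrite NH => -[_ []].
have [f fd fH] := hyperplane_kernel hH (notinH _ Nd).
have Nx : cone (A `&` points (L + <[w]>)) x.
  apply/cone_points; rewrite ?sub0v //; split; [by case: Sx|exact: slice_in_section].
have Ny : cone (A `&` points (L + <[w]>)) y.
  apply/cone_points; rewrite ?sub0v //; split; [by case: Sy|exact: slice_in_section].
(* Homogeneous form of convexity in the chart: weights [a * f v1 / s] and [b * f v2 / s] on the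
   normalized vectors give [s^-1 *: (a *: v1 + b *: v2)]. *)
have chart a b v1 v2 : cone (A `&` points (L + <[w]>)) v1 ->
    cone (A `&` points (L + <[w]>)) v2 -> 0 <= a * f v1 -> 0 <= b * f v2 ->
    0 < a * f v1 + b * f v2 -> cone A (a *: v1 + b *: v2).
  move=> N1 N2; have f1 := notinH _ N1; have f2 := notinH _ N2.
  rewrite fH in f1; rewrite fH in f2.
  set s := _ + _ => a0 b0 s0.
  have fs v : f v != 0 -> cone (A `&` points (L + <[w]>)) v ->
      (cone (A `&` points (L + <[w]>)) `&` [set v0 | v0 - d \in H])
        ((f v)^-1 *: v).
    move=> fv Nv; split; first by apply/coneZ; rewrite ?invr_eq0.
    by rewrite /= fH linearB linearZ /= fd mulVf // subrr.
  have s01 : 0 <= a * f v1 / s <= 1.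
    by rewrite divr_ge0 ?(ltW s0) //= ler_pdivrMr // mul1r /s lerDl.
  have /convex_setP/(_ _ _ _ s01 (fs _ f1 N1) (fs _ f2 N2)) := cH d (notinH _ Nd).
  rewrite (_ : _ + _ = s^-1 *: (a *: v1 + b *: v2)).
    by case; rewrite coneZ ?invr_eq0 ?gt_eqF // cone_points ?sub0v // => -[].
  have -> : 1 - a * f v1 / s = b * f v2 / s.
    by apply: (mulIf (lt0r_neq0 s0)); rewrite mulrBl mul1r !divfK ?gt_eqF // /s; ring.
  rewrite !scalerA scalerDr !scalerA.
  by congr (_ *: _ + _ *: _); rewrite mulrAC mulfK // mulrC.
have mix a b : 0 < a -> 0 < b -> 0 < t * a + (1 - t) * b.
  move=> a0 b0; move: t0; rewrite le_eqVlt => /predU1P[<-|{}t0]; first lra.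
  by rewrite ltr_pwDl ?mulr_gt0 ?mulr_ge0 ?subr_ge0 // ltW.
have fx := notinH _ Nx; have fy := notinH _ Ny.
rewrite fH in fx; rewrite fH in fy.
split; last first.
  have -> : t *: x + (1 - t) *: y - w = t *: (x - w) + (1 - t) *: (y - w).
    by rewrite !scalerBr addrACA -opprD -scalerDl [t + _]addrC subrK scale1r.
  by rewrite rpredD // rpredZ //; [case: Sx|case: Sy].
have [fxy|fxy] : 0 < f x * f y \/ f x * f y < 0.
  by move: (mulf_neq0 fx fy); rewrite neq_lt => /orP[]; [right|left].
- have [[x0 y0]|[x0 y0]] : (0 < f x /\ 0 < f y) \/ (f x < 0 /\ f y < 0).
    move: fx; case: (ltgtP (f x) 0) => // x0 _.
      by right; split=> //; rewrite -(nmulr_rgt0 _ x0).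
    by left; split=> //; rewrite -(pmulr_rgt0 _ x0).
  + by apply: chart => //; [nra|nra|exact: mix].
  + apply/coneN; rewrite opprD -!scaleNr; apply: chart => //; [nra|nra|].
    by rewrite !mulNr -!mulrN; apply: mix; rewrite oppr_gt0.
- exfalso; apply: (@cone_disjoint (x - y)); last first.
    have -> : x - y = (x - w) - (y - w) by rewrite opprB addrA subrK.
    by rewrite rpredB //; [case: Sx|case: Sy].
  have [x0|x0] := ltP 0 (f x).
    have y0 : f y < 0 by rewrite -(pmulr_rlt0 _ x0).
    by rewrite -[x]scale1r -scaleN1r; apply: chart => //; lra.
  have {}x0 : f x < 0 by rewrite lt_neqAle fx.
  have y0 : 0 < f y by rewrite -(nmulr_rlt0 _ x0).
  apply/coneN; rewrite opprB -[y]scale1r -scaleN1r.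
  by apply: chart => //; lra.
Qed.

End Slices.

(** Let [f] be 1 at [w] and 0 on [L]. On the compact set [K] of unit vectors over the section, [|f|]
    has a positive minimum, since a zero of [f] there would lie in [L]. As [f] is 1 on the slice,
    this minimum bounds the norm of its vectors. *)
Lemma slice_compact (R : realType) (n : nat) (L : proj_subspace R n)
    (A : set (RP R n)) (w : 'rV[R]_n.+1) :
  convex_concave L A -> w \notin L -> compact (slice L A w).
Proof.
move=> ccA wL; have [cA _ _ _] := ccA.
have [f fw fL] := scalar_separation wL; have cf := @scalar_continuous _ _ f.
have clW (W : proj_subspace R n) : closed [set v | v \in W].
  rewrite (_ : mkset _ = ~` [set v | v \notin W]); first exact/open_closedC/open_notin_vspace.
  by apply/seteqP; split=> v /=; [move=> -> | move/negP; rewrite negbK].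
(* This set is the cone over [A] together with the zero vector; the latter is not in [w + L]. *)
have clK : closed (~` cone (~` A)) by apply: open_closedC; rewrite -pquot_openE openC.
have sliceE : slice L A w = ~` cone (~` A) `&` [set v | v - w \in L].
  apply/seteqP; split=> v [Av vw]; split=> //; first by rewrite /= coneC => -[].
  have v0 : v \notin (0%VS : proj_subspace R n).
    rewrite memv0; apply: contra wL => /eqP v0.
    by move: vw; rewrite /= v0 sub0r rpredN.
  by apply: contrapT => nAv; apply: Av; apply/coneC.
have [->|/set0P S0] := eqVneq (slice L A w) set0; first exact: compact0.
pose K := [set v : 'rV[R]_n.+1 | `|v| = 1] `&`
  (~` cone (~` A) `&` [set v | v \in (L + <[w]>)%VS]).
have cK : compact K.
  apply: bounded_closed_compact.
    by exists 1; split=> // x x1 v [/= -> _]; exact: ltW.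
  apply: closedI; last by apply: closedI => //; exact: clW.
  rewrite (_ : mkset _ = (fun v : 'rV[R]_n.+1 => `|v|) @^-1` [set 1]) //.
  apply: closed_comp => [v _|]; [exact: norm_continuous|exact: closed_eq].
have inK v : slice L A w v -> K (`|v|^-1 *: v).
  move=> Sv; have v0 : `|v| != 0.
    by rewrite normr_eq0; apply: contra (slice_notin wL Sv) => /eqP ->; rewrite mem0v.
  split; first by rewrite /= normrZ normfV normr_id mulVf.
  split; last by rewrite /= rpredZ // (slice_in_section Sv).
  by rewrite /= coneC coneZ ?invr_eq0 //; case=> _; apply; case: Sv.
have K0 : K !=set0 by case: S0 => v /inK; exists (`|v|^-1 *: v).
have cnf : continuous (fun v => `|f v|).
  by move=> v; apply: continuous_comp; [exact: cf|exact: norm_continuous].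
have [c [c1 [Ac cN]] cmin] := compact_min K0 cK cnf.
have fc : 0 < `|f c|.
  rewrite normr_gt0; apply/eqP => fc.
  have [l lL [_ /vlineP[k ->] cE]] := memv_addP cN.
  move: fc; rewrite cE linearD linearZ /= fw mulr1 fL // add0r => k0.
  have cL : c \in L by rewrite cE k0 scale0r addr0.
  apply: (@cone_disjoint _ _ _ _ ccA c) => //; apply: contrapT => nAc; apply: Ac.
  apply/coneC; split=> //; rewrite memv0; apply/eqP => c0.
  by move: c1; rewrite /= c0 normr0 => /eqP; rewrite eq_sym oner_eq0.
apply: bounded_closed_compact.
  exists (`|f c|^-1); split=> // x cx v Sv.
  apply: (le_trans _ (ltW cx)).
  have := cmin _ (inK _ Sv).
  rewrite linearZ /= normrM normfV normr_id.
  have -> : f v = 1.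
    have [_ /fL] := Sv.
    by rewrite linearB /= fw => /eqP; rewrite subr_eq0 => /eqP.
  rewrite normr1 mulr1 => h.
  by rewrite -[`|v|]invrK lef_pV2 // posrE (lt_le_trans fc).
rewrite sliceE; apply: closedI => //.
rewrite (_ : mkset _ = (fun v => v - w) @^-1` [set v | v \in L]) //.
apply: closed_comp => // v _; apply: continuousB; [exact: cvg_id|exact: cst_continuous].
Qed.

(** * Three sections: extending a point of one section to the other two *)

Lemma three_sections (R : realType) (n : nat) (L : proj_subspace R n)
    (A : set (RP R n)) (e1 e2 p : 'rV[R]_n.+1) (a b : R) :
  convex_concave L A -> e1 \notin L -> a *: e1 + b *: e2 \notin L ->
  slice L A e2 p -> exists2 q, slice L A e1 q &
    slice L A (a *: e1 + b *: e2) (a *: q + b *: p).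
Proof.
move=> ccA e1L wL Sp; set w := a *: e1 + b *: e2 in wL *.
have [q0 Sq0] := slice_neq0 ccA e1L.
(* If [a] or [b] is zero, [w] is a multiple of [e2] or [e1], and rescaling [p] or [q0] suffices. *)
have [a0|a0] := eqVneq a 0.
  have b0 : b != 0.
    by apply: contra wL => /eqP b0; rewrite /w a0 b0 !scale0r addr0 mem0v.
  by exists q0; rewrite // /w a0 !scale0r !add0r; apply/sliceZ.
have [b0|b0] := eqVneq b 0.
  by exists q0; rewrite // /w b0 !scale0r !addr0; apply/sliceZ.
have [w0 Sw0] := slice_neq0 ccA wL.
apply: contrapT => noq.
have {}noq q : slice L A e1 q -> ~ slice L A w (a *: q + b *: p).
  by move=> Sq Sw; apply: noq; exists q.
(* The zero second component reduces [nearest_point] to a single residual. *)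
pose g (z : 'rV[R]_n.+1 * 'rV[R]_n.+1) : 'rV[R]_n.+1 * 'rV[R]_n.+1 :=
  (z.1 - (a *: z.2 + b *: p), 0).
have gc : continuous g.
  apply: continuous_pair; last exact: cst_continuous.
  by apply: continuous_residual => z; [exact: cvg_fst|exact: cvg_snd|exact: cvg_cst].
have [|||_ [[v q] [/= Sv Sq] <-] /= dmin] :=
    @nearest_point _ _ (g @` (slice L A w `*` slice L A e1)).
- by exists (g (w0, q0)), (w0, q0).
- apply: continuous_compact; first exact: continuous_subspaceT.
  by apply: compact_setX; exact: slice_compact.
- apply/convex_setP => _ _ t t01 [[v1 q1] [/= Sv1 Sq1] <-] [[v2 q2] [/= Sv2 Sq2] <-].
  exists (t *: v1 + (1 - t) *: v2, t *: q1 + (1 - t) *: q2).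
    have /convex_setP cw := slice_convex ccA wL.
    have /convex_setP c1 := slice_convex ccA e1L.
    by split; [exact: cw|exact: c1].
  apply: injective_projections; rewrite /= ?scaler0 ?addr0 //.
  by apply/rowP => j; rewrite !mxE; ring.
set d := v - _ in dmin.
have {dmin} dmin v' q' : slice L A w v' -> slice L A e1 q' ->
    dot d d <= dot d (v' - (a *: q' + b *: p)).
  move=> Sv' Sq'; have := dmin (g (v', q')); rewrite /g /= => h.
  by have := h _; rewrite (linear0 (dot 0)) !addr0; apply; exists (v', q').
have d0 : d != 0.
  by apply/eqP => /subr0_eq dE; apply: (noq _ Sq); rewrite -dE.
have dd : 0 < dot d d by rewrite lt_neqAle eq_sym dot_eq0 d0 dot_ge0.
have inL v' q' : v' - w \in L -> q' - e1 \in L -> v' - (a *: q' + b *: p) \in L.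
  move=> v'w q'e; have -> : v' - (a *: q' + b *: p) =
      (v' - w) - (a *: (q' - e1) + b *: (p - e2)).
    by apply/rowP => j; rewrite !mxE; ring.
  by apply: rpredB => //; apply: rpredD; apply: rpredZ => //; case: Sp.
have dL : d \in L by apply: inL; [case: Sv|case: Sq].
pose k : 'Hom('rV[R]_n.+1, R^o) := linfun (dot d).
have kE z : k z = dot d z by rewrite lfunE.
(* The center [T] is the orthogonal complement of the shortest residual [d] in [L], so [L] is [T +
   <[d]>] and condition 3 applies. *)
pose T : proj_subspace R n := (L :&: lker k)%VS.
have memT z : (z \in T) = (z \in L) && (dot d z == 0) by rewrite memv_cap memv_ker kE.
have TL : (T <= L)%VS by exact: capvSl.
have dT : d \notin T by rewrite memT (gt_eqF dd) andbF.
have projT z : z \in L -> z - (dot d z / dot d d) *: d \in T.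
  move=> zL; rewrite memT rpredB ?rpredZ //=.
  by rewrite linearB linearZ /= divfK ?(gt_eqF dd) ?subrr.
have dimT : pdim T = pdim L - 1.
  have -> : L = (T + <[d]>)%VS.
    apply/eqP; rewrite eqEsubv; apply/andP; split; last by rewrite subv_add TL -memvE.
    apply/subvP => z /projT zT; rewrite -(subrK ((dot d z / dot d d) *: d) z).
    by rewrite memv_add // rpredZ // memv_line.
  by rewrite /pdim dim_addv_line //; lia.
have [_ _ _ /(_ T TL dimT)[_ [_ [H [hH TH CH cH]]]]] := ccA.
have outT z : z \notin L -> z \notin T by apply: contra; exact: subvP TL z.
have notC z : z \in H -> ~ cone (~` projection T A) z.
  move=> zH Cz; have : cone (~` projection T A `&` points H) z by apply/cone_points.
  by rewrite CH => -[_ []].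
(* Every [d + t] with [t] in [T] lies in [L], which [A] misses; hence [d] lies over the complement
   of the projection, which [H] avoids. *)
have dH : d \notin H.
  apply/negP => dH; apply: (notC _ dH); apply/coneC; split=> //.
  case/cone_projection => _ [t tT Adt].
  by apply: (cone_disjoint ccA Adt); rewrite rpredD // (subvP TL).
have [f fd fH] := hyperplane_kernel hH dH.
have fD z z' : f (z + z') = f z + f z' by exact: linearD.
have fN z : f (- z) = - f z by exact: linearN.
have fB z z' : f (z - z') = f z - f z' by exact: linearB.
have fZ c z : f (c *: z) = c * f z by exact: linearZ.
have fT z : z \in T -> f z = 0 by move/(subvP TH); rewrite fH => /eqP.
(* Both functionals vanish on [T] and are 1 at [d], so they agree on [L]. *)
have fL z : z \in L -> f z = dot d z / dot d d.
  by move/projT/fT/eqP; rewrite fB fZ fd mulr1 subr_eq0 => /eqP.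
have memTf z : z \in L -> f z = 0 -> z \in T.
  move=> zL /eqP; rewrite fL // memT zL /= mulf_eq0 invr_eq0 (gt_eqF dd) orbF //.
(* The points of H / T are not in the complement of the projection of A, so
   every section meets H. *)
have meetH e : e \notin L -> exists2 z, slice L A e z & f z = 0.
  move=> eL; pose z := e - f e *: d.
  have zL : z - e \in L by rewrite /z addrAC subrr sub0r rpredN rpredZ.
  have zNL : z \notin L by apply: contra eL => zL'; rewrite -(subKr z e) rpredB.
  have fz : f z = 0 by rewrite fB fZ fd mulr1 subrr.
  have [t tT Azt] : exists2 t, t \in T & cone A (z + t).
    apply: contrapT => h; apply: (notC z); first by rewrite fH fz.
    by apply/coneC; split; [exact: outT|case/cone_projection].
  exists (z + t); last by rewrite fD fz fT // addr0.
  by split=> //; rewrite addrAC rpredD // (subvP TL).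
(* Translation by [T] preserves [f], so a value of [f] not taken on the slice of [e] gives vectors
   of [e + L] outside the cone of the projection. *)
have inC e z : e \notin L -> z - e \in L -> (forall q, slice L A e q -> f q != f z) ->
    cone (~` projection T A) z.
  move=> eL zL fz; apply/coneC.
  have zNL : z \notin L by apply: contra eL => zL'; rewrite -(subKr z e) rpredB.
  split; first exact: outT.
  case/cone_projection => _ [t tT Azt].
  have /fz : slice L A e (z + t).
    by split=> //; rewrite addrAC rpredD // (subvP TL).
  by rewrite fD (fT t) // addr0 eqxx.
have [v1 Sv1 fv1] := meetH _ wL; have [q1 Sq1 fq1] := meetH _ e1L.
have gap v' q' : slice L A w v' -> slice L A e1 q' ->
    1 <= f v' - a * f q' - b * f p.
  move=> Sv' Sq'.
  have -> : f v' - a * f q' - b * f p = f (v' - (a *: q' + b *: p)).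
    by rewrite !(fB, fD, fZ); ring.
  rewrite fL; last by apply: inL; [case: Sv'|case: Sq'].
  by rewrite ler_pdivlMr // mul1r; exact: dmin.
have [vm Svm vmin] := compact_min (ex_intro _ _ Sv1) (slice_compact ccA wL)
  (@scalar_continuous _ _ f).
(* [s1] is below every value of [f] on the slice of [w]. By [gap], [s2] is above every value of
   [a * f] on the slice of [e1]. Since [f] vanishes at [v1] and [q1], the two numbers have opposite
   signs. *)
pose s1 := f vm - 2^-1; pose s2 := s1 - b * f p.
have s1_lt0 : s1 < 0 by have := vmin _ Sv1; rewrite fv1 /s1; lra.
have s2_gt0 : 0 < s2 by have := gap _ _ Svm Sq1; rewrite fq1 /s2 /s1; lra.
pose z1 := w + (s1 - f w) *: d; pose z2 := a *: e1 + (s2 - a * f e1) *: d.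
have fz1 : f z1 = s1 by rewrite fD fZ fd; ring.
have fz2 : f z2 = s2 by rewrite fD !fZ fd; ring.
have Cz1 : cone (~` projection T A) z1.
  apply: (inC w) => // [|q' Sq']; first by rewrite /z1 addrAC subrr add0r rpredZ.
  by rewrite fz1 gt_eqF //; have := vmin _ Sq'; rewrite /s1; lra.
have Cz2 : cone (~` projection T A) z2.
  apply: (inC (a *: e1)) => [||q' Sq'].
  - by rewrite rpredZeq (negPf a0).
  - by rewrite /z2 addrAC subrr add0r rpredZ.
  have Sq'' : slice L A e1 (a^-1 *: q') by apply/(sliceZ _ _ _ _ a0); rewrite scalerKV.
  rewrite fz2 lt_eqF //; have := gap _ _ Svm Sq''.
  by rewrite fZ mulrA divff // mul1r /s2 /s1; lra.
have chart z : f z != 0 -> cone (~` projection T A) z ->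
    (cone (~` projection T A) `&` [set z | z - d \in H]) ((f z)^-1 *: z).
  move=> fz Cz; split; first by apply/coneZ; rewrite ?invr_eq0.
  by rewrite /= fH fB fZ fd mulVf // subrr.
(* With this weight the chart segment joining [z2] and [z1] passes through a multiple of
   [z2 - z1]. *)
have t01 : 0 <= s2 / (s2 - s1) <= 1.
  by rewrite divr_ge0 /= ?ler_pdivrMr; lra.
have fz1N0 : f z1 != 0 by rewrite fz1 lt_eqF.
have fz2N0 : f z2 != 0 by rewrite fz2 gt_eqF.
have /convex_setP/(_ _ _ _ t01 (chart _ fz2N0 Cz2) (chart _ fz1N0 Cz1))[] := cH d dH.
have s21 : s2 - s1 != 0 by rewrite gt_eqF //; lra.
rewrite (_ : _ + _ = (s2 - s1)^-1 *: (z2 - z1)); last first.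
  rewrite fz1 fz2 in fz1N0 fz2N0 *.
  by apply/rowP => j; rewrite !mxE; field; rewrite fz1N0 fz2N0 s21.
rewrite coneZ ?invr_eq0 // => /coneC[z21T nP] _; apply: nP.
(* Modulo [L], [z2 - z1] is [- b *: e2], hence [- b *: p]; the values of [f] agree too, so the two
   differ by a vector of [T]. Thus [z2 - z1] lies over the image of [p], which is in the
   projection. *)
apply/cone_projection; split=> //; exists (- (b *: p) - (z2 - z1)); last first.
  by rewrite addrC subrK coneN coneZ //; case: Sp.
apply: memTf; last first.
  by rewrite !fB fN fZ fz1 fz2 /s2; ring.
have -> : - (b *: p) - (z2 - z1) =
    (s1 - f w - (s2 - a * f e1)) *: d - b *: (p - e2).
  by apply/rowP => j; rewrite !mxE; ring.
by apply: rpredB; apply: rpredZ => //; case: Sp.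
Qed.

(** * Four sections: vanishing of the minimal residuals *)

Lemma four_sections (R : realType) (n : nat) (L : proj_subspace R n)
    (A : set (RP R n)) (e1 e2 : 'rV[R]_n.+1) (a1 b1 a2 b2 : R) :
  convex_concave L A -> e1 \notin L -> e2 \notin L ->
  a1 *: e1 + b1 *: e2 \notin L -> a2 *: e1 + b2 *: e2 \notin L ->
  exists x y, [/\ slice L A e1 x, slice L A e2 y,
    slice L A (a1 *: e1 + b1 *: e2) (a1 *: x + b1 *: y) &
    slice L A (a2 *: e1 + b2 *: e2) (a2 *: x + b2 *: y)].
Proof.
move=> ccA e1L e2L; set f1 := a1 *: e1 + _; set f2 := a2 *: e1 + _ => f1L f2L.
pose V := 'rV[R]_n.+1.
pose g (z : (V * V) * (V * V)) : V * V :=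
  (z.1.1 - (a1 *: z.2.1 + b1 *: z.2.2), z.1.2 - (a2 *: z.2.1 + b2 *: z.2.2)).
pose S := (slice L A f1 `*` slice L A f2) `*` (slice L A e1 `*` slice L A e2).
have gc : continuous g.
  have c11 z : {for z, continuous (fun z : (V * V) * (V * V) => z.1.1)}.
    exact: (@continuous_comp _ _ _ fst fst z (@cvg_fst _ _ _ _ _) (@cvg_fst _ _ _ _ _)).
  have c12 z : {for z, continuous (fun z : (V * V) * (V * V) => z.1.2)}.
    exact: (@continuous_comp _ _ _ fst snd z (@cvg_fst _ _ _ _ _) (@cvg_snd _ _ _ _ _)).
  have c21 z : {for z, continuous (fun z : (V * V) * (V * V) => z.2.1)}.
    exact: (@continuous_comp _ _ _ snd fst z (@cvg_snd _ _ _ _ _) (@cvg_fst _ _ _ _ _)).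
  have c22 z : {for z, continuous (fun z : (V * V) * (V * V) => z.2.2)}.
    exact: (@continuous_comp _ _ _ snd snd z (@cvg_snd _ _ _ _ _) (@cvg_snd _ _ _ _ _)).
  apply: continuous_pair; first exact: (continuous_residual c11 c21 c22).
  exact: (continuous_residual c12 c21 c22).
have [|||_ [[[w1 w2] [x y]] [/= [Sw1 Sw2] [Sx Sy]] <-] rmin] :=
    @nearest_point _ _ (g @` S).
- have [w1 Sw1] := slice_neq0 ccA f1L; have [w2 Sw2] := slice_neq0 ccA f2L.
  have [x Sx] := slice_neq0 ccA e1L; have [y Sy] := slice_neq0 ccA e2L.
  by exists (g ((w1, w2), (x, y))), ((w1, w2), (x, y)).
- apply: continuous_compact; first exact: continuous_subspaceT.
  by do ![apply: compact_setX]; exact: slice_compact.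
- apply/convex_setP => _ _ t t01 [z Sz <-] [z' Sz' <-].
  exists (t *: z + (1 - t) *: z').
    have cv w : w \notin L -> forall u v, slice L A w u -> slice L A w v ->
        slice L A w (t *: u + (1 - t) *: v).
      by move=> wL u v Su Sv; have /convex_setP := slice_convex ccA wL; exact.
    case: Sz Sz' => -[? ?] [? ?] [[? ?] [? ?]].
    by split; split; apply: cv.
  by apply: injective_projections; apply/rowP => j; rewrite /= !mxE; ring.
move: rmin; move rE : (g _) => r rmin.
have [p Sp pmin] := compact_min (slice_neq0 ccA e2L) (slice_compact ccA e2L)
  (@scalar_continuous _ _ (b1 \*: dot r.1)).
have [p' Sp' p'min] := compact_min (slice_neq0 ccA e1L) (slice_compact ccA e1L)
  (@scalar_continuous _ _ (a2 \*: dot r.2)).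
have [q Sq Sw1'] := three_sections ccA e1L f1L Sp.
(* For [f2] the roles of [e1] and [e2] are exchanged: the given point is [p'] in the slice of
   [e1]. *)
have f2E : f2 = b2 *: e2 + a2 *: e1 by rewrite addrC.
have [|q' Sq' Sw2'] := @three_sections _ _ L A e2 e1 p' b2 a2 ccA e2L _ Sp'.
  by rewrite -f2E.
rewrite -f2E [_ + a2 *: p']addrC in Sw2'.
pose z := ((a1 *: q + b1 *: p, a2 *: p' + b2 *: q'), (q, q')).
have gz : g z = (b1 *: (p - q'), a2 *: (p' - q)).
  by apply: injective_projections; apply/rowP => j; rewrite /= !mxE; ring.
have Sz : S z by split; split.
have := rmin _ (imageP g Sz); rewrite gz /= !dotZr !dotBr => le_r.
(* Both terms are nonpositive: [q'] competes with the minimizer [p], and [q] with [p']. *)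
have {}le_r : dot r.1 r.1 + dot r.2 r.2 <= 0.
  apply: (le_trans le_r).
  have le1 : b1 * dot r.1 p <= b1 * dot r.1 q' by exact: pmin.
  have le2 : a2 * dot r.2 p' <= a2 * dot r.2 q by exact: p'min.
  by rewrite !mulrBr; lra.
have [r1 r2] : r.1 = 0 /\ r.2 = 0.
  have := dot_ge0 r.1; have := dot_ge0 r.2 => h2 h1.
  by split; apply/eqP; rewrite -dot_eq0 eq_le ?h1 ?h2 andbT; lra.
rewrite -rE in r1 r2.
by exists x, y; split=> //; [rewrite -(subr0_eq r1)|rewrite -(subr0_eq r2)].
Qed.

(** * The line meeting four sections *)

Theorem proposition1 (R : realType) (n : nat) (L : proj_subspace R n)
    (A : set (RP R n)) :
  pdim L = n%:Z - 2 ->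
  convex_concave L A ->
  forall N : 'I_4 -> proj_subspace R n,
    (forall i, hyperplane (N i) /\ (L <= N i)%VS) ->
    exists l : proj_subspace R n,
      pdim l = 1 /\
      forall i, (A `&` points (N i)) `&` points l !=set0.
Proof.
move=> dL ccA N hN.
have {}dL : n = (\dim L).+1 by move: dL; rewrite /pdim; lia.
have /choice[w wN] : forall i, exists v, v \in N i /\ v \notin L.
  move=> i; have [hi LNi] := hN i.
  have : ~~ (N i <= L)%VS.
    by apply/negP => /dimvS; move: hi; rewrite /hyperplane /pdim; lia.
  by case/subvPn => v vN vL; exists v.
pose e1 := w 0; have e1L : e1 \notin L by have [] := wN 0.
(* [N 0] and [N 1] may coincide; then [e2] is any vector outside [L + <[e1]>]. In either case [e1]
   and [e2] span a complement of [L]. *)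
have [e2 e2E e2L1] : exists2 e2, (w 1 \in L + <[e1]> \/ e2 = w 1)%VS &
    e2 \notin (L + <[e1]>)%VS.
  have [w1|w1] := boolP (w 1 \in L + <[e1]>)%VS; last by exists (w 1) => //; right.
  have : ~~ (fullv <= L + <[e1]>)%VS.
    apply/negP => /dimvS; rewrite dim_addv_line // dimvf /dim /= mul1n.
    by move: dL; lia.
  by case/subvPn => v _ vL; exists v => //; left.
have e2L : e2 \notin L by apply: contra e2L1; exact: subvP (addvSl _ _) _.
have full v : exists a b, v - (a *: e1 + b *: e2) \in L.
  have : v \in (L + <[e1]> + <[e2]>)%VS.
    suff /eqP -> : (L + <[e1]> + <[e2]>)%VS == fullv by rewrite memvf.
    by rewrite eqEdim subvf !dim_addv_line // dimvf /dim /= mul1n -dL.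
  case/memv_addP => _ /memv_addP[l lL [_ /vlineP[a ->] ->]] [_ /vlineP[b ->] ->].
  by exists a, b; rewrite -[l + _ + _]addrA addrK.
have inN i v : v - w i \in L -> v \in N i.
  by move=> vw; rewrite -(subrK (w i) v) rpredD ?(wN i).1 // (subvP (hN i).2).
have notinL i v : w i - v \in L -> v \notin L.
  move=> wv; apply: contra (wN i).2 => vL.
  by rewrite -(subrK v (w i)) rpredD.
have [a1 [b1 f1]] := full (w 2); have [a2 [b2 f2]] := full (w 3).
have [x [y [Sx Sy S1 S2]]] :=
  four_sections ccA e1L e2L (notinL _ _ f1) (notinL _ _ f2).
have xL := slice_notin e1L Sx; have [Ax xe1] := Sx; have [Ay ye2] := Sy.
have x0 : x \notin (0%VS : proj_subspace R n).
  by apply: contra xL; rewrite memv0 => /eqP ->; rewrite mem0v.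
(* [x] and [y] are congruent to [e1] and [e2] modulo [L], so they are independent and span a
   projective line. *)
have yx : y \notin <[x]>%VS.
  apply: contra e2L1 => /vlineP[k yE].
  have -> : e2 = (k *: (x - e1) - (y - e2)) + k *: e1.
    by rewrite yE; apply/rowP => j; rewrite !mxE; ring.
  apply: memv_add; last by rewrite rpredZ // memv_line.
  by apply: rpredB => //; exact: rpredZ.
exists (<[x]> + <[y]>)%VS; split.
  rewrite /pdim dim_addv_line // -[<[x]>%VS]add0v dim_addv_line //.
  by rewrite dimv0.
have meet i v : cone A v -> v \in N i -> v \in (<[x]> + <[y]>)%VS ->
    A `&` points (N i) `&` points (<[x]> + <[y]>)%VS !=set0.
  move=> Av vN vl.
  have [_ [z Az _]] : cone (A `&` points (N i) `&` points (<[x]> + <[y]>)%VS) v.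
    by rewrite !cone_points ?sub0v.
  by exists z.
have xl : x \in (<[x]> + <[y]>)%VS by rewrite memvE addvSl.
have yl : y \in (<[x]> + <[y]>)%VS by rewrite memvE addvSr.
have lxy a b : a *: x + b *: y \in (<[x]> + <[y]>)%VS by rewrite rpredD ?rpredZ.
have w_slice i v a b : v - (a *: e1 + b *: e2) \in L ->
    w i - (a *: e1 + b *: e2) \in L -> v \in N i.
  move=> vf wf; apply: inN.
  have -> : v - w i = (v - (a *: e1 + b *: e2)) - (w i - (a *: e1 + b *: e2)).
    by rewrite opprB addrA subrK.
  exact: rpredB.
move=> i; have : [|| i == 0, i == 1, i == 2 | i == 3] by case: i => -[|[|[|[|]]]].
case/or4P => /eqP ->.
- by apply: (meet _ x) => //; exact: inN.
(* If [w 1] lies in [L + <[e1]>], a multiple of [x] is congruent to it modulo [L], so the point of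
   [x] serves for [N 1] as well. *)
- case: e2E => [/memv_addP[l lL [_ /vlineP[k ->] w1E]]|e2E].
    have k0 : k != 0.
      apply/eqP => k0; move: (wN 1).2; rewrite w1E k0 scale0r addr0 lL //.
    apply: (meet _ (k *: x)); first by apply/coneZ.
      apply: inN; rewrite w1E opprD addrCA -scalerBr rpredD ?rpredN ?rpredZ //.
    by rewrite rpredZ.
  by apply: (meet _ y) => //; apply: inN; rewrite -e2E.
- by case: S1 => ? ?; apply: (meet _ (a1 *: x + b1 *: y)) => //; exact: w_slice f1.
- by case: S2 => ? ?; apply: (meet _ (a2 *: x + b2 *: y)) => //; exact: w_slice f2.
Qed.
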